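(* Let $G$ be a finite group. For all $g,h,i\in G$, $$D(g^{-1})=D(g),$$ $$C(h^{-1},g^{-1})=C(h,g)=C(g,h),$$ $$P(g^{-1},h^{-1},i^{-1})=P(g,i,h).$$
   Context: For a finite group $G$ with identity element $1$ and $g,h,i\in G$, define $$D(g):=\begin{cases}1,& g=1\\ 0,& g\neq 1,\end{cases}\qquad C(g,h):=\#\{k\in G\mid g=khk^{-1}\},$$ $$P(g,i,h):=\#\{(j_1,j_2)\in G^2\mid g=j_2\,i\,j_2^{-1}\,j_1\,h\,j_1^{-1}\}.$$ *)

(* Defs.v *)
From mathcomp Require Import all_boot all_fingroup.

Set Implicit Arguments.
Unset Strict Implicit.
Unset Printing Implicit Defensive.

Local Open Scope group_scope.

(* Conjugation is written out as k * h * k^-1: MathComp's h ^ k is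
   k^-1 * h * k. *)

Definition D (G : finGroupType) (g : G) : nat := if g == 1 then 1%N else 0%N.

Definition C (G : finGroupType) (g h : G) : nat :=
  #|[set k : G | g == k * h * k^-1]|.

(* A pair j stands for (j_1, j_2). *)
Definition P (G : finGroupType) (g i h : G) : nat :=
  #|[set j : G * G | g == j.2 * i * j.2^-1 * j.1 * h * j.1^-1]|.

(* Main.v *)
Require Import Defs.
From mathcomp Require Import all_boot all_fingroup.
Local Open Scope group_scope.

(** Inverting both sides of a defining equation gives an equivalent one. Inversion fixes [1] and
    commutes with conjugation, so [D] and [C] count the same solutions; it reverses products, so [P]
    needs a bijection of pairs. *)

Lemma D_inv (G : finGroupType) (g : G) : D g^-1 = D g.
Proof. by rewrite /D invg_eq1. Qed.

Lemma C_inv (G : finGroupType) (g h : G) : C g^-1 h^-1 = C g h.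
Proof.
apply: eq_card => k; rewrite !inE -(inj_eq invg_inj).
by rewrite !invMg !invgK mulgA.
Qed.

(** Solving [g = k * h * k^-1] for [h] gives [h = k^-1 * g * k], so [k] solves one equation exactly
    when [k^-1] solves the other. *)
Lemma C_sym (G : finGroupType) (g h : G) : C g h = C h g.
Proof.
rewrite /C -[RHS](card_preimset _ invg_inj).
apply: eq_card => k; rewrite !inE invgK eq_sym.
by rewrite (can2_eq (mulgKV _) (mulgK _)) (can2_eq (mulKg _) (mulKVg _)) mulgA.
Qed.

(* Inverting the equation reverses the two conjugates, so [j.1] and [j.2] trade
   roles. *)
Lemma P_inv (G : finGroupType) (g h i : G) : P g^-1 h^-1 i^-1 = P g i h.
Proof.
have swap_inj : injective (fun j : G * G => (j.2, j.1)).
  by move=> [a b] [c d] [-> ->].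
rewrite /P -[RHS](card_preimset _ swap_inj).
apply: eq_card => j; rewrite !inE /= -(inj_eq invg_inj).
by rewrite !invMg !invgK !mulgA.
Qed.

Theorem corollary6p2 (G : finGroupType) (g h i : G) :
  D g^-1 = D g /\
  (C h^-1 g^-1 = C h g /\ C h g = C g h) /\
  P g^-1 h^-1 i^-1 = P g i h.
Proof.
split; first exact: D_inv.
by split; [split; [exact: C_inv | exact: C_sym] | exact: P_inv].
Qed.
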